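(* Let $-1<\nu<-\frac12$. Then the Fourier--Bessel transform $\mathcal{F}_\nu$ does not have the Riemann--Lebesgue property; that is, $\mathcal{F}_\nu$ does not map $\operatorname{dom}(\mathcal{F}_\nu)$ into $C_0(\mathbb{R}^+)$.
   Context: $\mathbb{R}^+=(0,\infty)$. $J_\nu(x)=\sum_{n=0}^\infty \frac{(-1)^n}{n!\,\Gamma(n+\nu+1)}\left(\frac{x}{2}\right)^{2n+\nu}$ is the Bessel function of the first kind and $\varphi_\nu(x)=x^{-\nu}J_\nu(x)$. The Fourier--Bessel transform of order $\nu$ is $\mathcal{F}_\nu f(y)=\int_{\mathbb{R}^+}\varphi_\nu(xy)f(x)x^{2\nu+1}\,dx$ for $y\in\mathbb{R}^+$. For $-1<\nu<-\frac12$ its domain is $\operatorname{dom}(\mathcal{F}_\nu)=L^1((0,R),x^{2\nu+1}\,dx)\cap L^1((R,\infty),x^{\nu+1/2}\,dx)$, i.e. functions $f$ on $\mathbb{R}^+$ with $\int_0^R|f(x)|x^{2\nu+1}\,dx+\int_R^\infty|f(x)|x^{\nu+1/2}\,dx<\infty$, where $R>1$ is a fixed large number. $C_0(\mathbb{R}^+)$ denotes the continuous functions on $\mathbb{R}^+$ that tend to $0$ at infinity. The Riemann--Lebesgue property of $\mathcal{F}_\nu$ is the property that it maps its domain into $C_0(\mathbb{R}^+)$. *)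

(* Defs.v *)
From mathcomp Require Import all_boot all_order all_algebra.
From mathcomp Require Import all_classical all_reals all_analysis.

Set Implicit Arguments.
Unset Strict Implicit.
Unset Printing Implicit Defensive.

Import Order.TTheory GRing.Theory Num.Theory.
Import numFieldNormedType.Exports.

Local Open Scope classical_set_scope.
Local Open Scope ring_scope.

Section FourierBessel.
Context {R : realType}.
Implicit Types (nu r : R) (f g : R -> R).

Local Notation mu := (@lebesgue_measure R).

(* Euler's integral: meaningful only for 0 < s.  In the Bessel series below
   it is evaluated at n + nu + 1, which is positive as soon as -1 < nu. *)
Definition Gamma (s : R) : R :=
  \int[mu]_(t in `]0, +oo[) (t `^ (s - 1) * expR (- t)).

(* For 0 < x and -1 < nu. *)
Definition besselJ_coef nu (x : R) (n : nat) : R :=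
  (-1) ^+ n / (n`!%:R * Gamma (n%:R + nu + 1))
    * (x / 2) `^ (2 * n%:R + nu).

Definition besselJ nu (x : R) : R := limn (series (besselJ_coef nu x)).

Definition bessel_phi nu (x : R) : R := x `^ (- nu) * besselJ nu x.

Definition fourier_bessel nu f (y : R) : R :=
  \int[mu]_(x in `]0, +oo[)
    (bessel_phi nu (x * y) * f x * x `^ (2 * nu + 1)).

(* L^1((0, r), x^(2 nu + 1) dx) `&` L^1((r, oo), x^(nu + 1/2) dx), the domain
   for -1 < nu < -1/2.  Only the values of f on ]0, +oo[ matter, and functions
   are not identified almost everywhere, since the transform does not depend on
   the representative. *)
Definition fourier_bessel_dom nu r : set (R -> R) :=
  [set f : R -> R | mu.-integrable `]0, r[ (fun x => (f x * x `^ (2 * nu + 1))%:E)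
        /\ mu.-integrable `]r, +oo[ (fun x => (f x * x `^ (nu + 2^-1))%:E)].

(* Continuous functions on ]0, +oo[ that tend to 0 at +oo; no condition is
   imposed near 0. *)
Definition C0_Rpos : set (R -> R) :=
  [set g : R -> R | {within `]0, +oo[, continuous g} /\ g y @[y --> +oo%R] --> (0 : R)].

Definition riemann_lebesgue_property nu r : Prop :=
  forall f, fourier_bessel_dom nu r f -> C0_Rpos (fourier_bessel nu f).

End FourierBessel.

(* Main.v *)
Require Import Defs.
From mathcomp Require Import all_boot all_order all_algebra.
From mathcomp Require Import all_classical all_reals all_analysis.
From mathcomp Require Import measurable_realfun ring lra.

(** Write phi(x) = x^(-nu) J_nu(x) = 2^(-nu) h(x^2), where the entire function h
    satisfies u h'' + (nu + 1) h' + h / 4 = 0.  For nu < -1/2 the energy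
    h^2 + 4 u h'^2 is nondecreasing, its logarithmic derivative is on average of
    order 1/u, and so it tends to infinity; this forces phi to be unbounded.
    The functionals g |-> \int_0^1 phi(x y) g(x) dx on L^1(0, 1) then have
    unbounded norms as y grows, and a gliding hump argument produces g for which
    they do not tend to 0; f(x) = g(x) x^(-2 nu - 1) on (0, 1) and f = 0 elsewhere
    lies in the domain and contradicts the Riemann-Lebesgue property. *)

Import Order.TTheory GRing.Theory Num.Theory.
Import numFieldNormedType.Exports.

Local Open Scope classical_set_scope.
Local Open Scope ring_scope.

(** * The Gamma function *)

Section GammaFunction.
Context {R : realType}.
Implicit Types a b s t : R.
Local Notation mu := (@lebesgue_measure R).

Lemma within_continuous_pos (f : R -> R) a b : 0 < a ->
  (forall x : R, 0 < x -> {for x, continuous f}) -> {within `[a, b], continuous f}.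
Proof.
move=> a0 cf; apply: continuous_in_subspaceT => x.
by rewrite inE/= in_itv/= => /andP[ax _]; apply: cf; exact: lt_le_trans ax.
Qed.

Lemma FTC2_pos (f F : R -> R) a b : 0 < a -> a < b ->
  (forall x : R, 0 < x -> is_derive x 1 F (f x)) ->
  (forall x : R, 0 < x -> {for x, continuous f}) ->
  (\int[mu]_(x in `[a, b]) (f x)%:E = (F b - F a)%:E)%E.
Proof.
move=> a0 ab dF cf.
have cF x : 0 < x -> {for x, continuous F}.
  move=> x0; apply: differentiable_continuous; apply/derivable1_diffP.
  by have [] := dF _ x0.
rewrite (@continuous_FTC2 _ f F)// ?EFinB//.
- exact: within_continuous_pos.
- split.
  + move=> x; rewrite in_itv/= => /andP[ax _].
    by have [] := dF _ (lt_trans a0 ax).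
  + by apply: cvg_at_right_filter; exact: cF.
  + by apply: cvg_at_left_filter; apply: cF; exact: lt_trans ab.
- move=> x; rewrite in_itv/= => /andP[ax _].
  by rewrite derive1E; have [_ ->] := dF _ (lt_trans a0 ax).
Qed.

(* From 1 + x <= expR x at x = t / (2 s). *)
Lemma powR_expRN_le s t : 0 < s -> 0 <= t ->
  t `^ s * expR (- t) <= (2 * s) `^ s * expR (- (t / 2)).
Proof.
move=> s0 t0.
have -> : expR (- t) = expR (- (t / 2)) * expR (- (t / 2)).
  by rewrite -expRD; congr expR; field.
rewrite mulrA ler_wpM2r ?expR_ge0//.
rewrite expRN ler_pdivrMr ?expR_gt0//.
have -> : t / 2 = t / (2 * s) * s by field; exact: lt0r_neq0.
rewrite expRM -powRM ?expR_ge0//; last by rewrite mulr_ge0// ltW.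
apply: ge0_ler_powR; rewrite ?nnegrE ?(ltW s0)//.
  by rewrite mulr_ge0 ?expR_ge0// mulr_ge0// ltW.
have s20 : 0 < 2 * s by rewrite mulr_gt0.
rewrite -ler_pdivrMl//; apply: le_trans (expR_ge1Dx _); lra.
Qed.

Definition gamma_integrand s t : R := t `^ (s - 1) * expR (- t).

Lemma continuous_powR_pos s (x : R) : 0 < x -> {for x, continuous (@powR R ^~ s)}.
Proof.
move=> x0; apply: differentiable_continuous; apply/derivable1_diffP.
by apply: derivable_powR; rewrite in_itv/= x0.
Qed.

Lemma continuous_expRN (x : R) : {for x, continuous (fun t : R => expR (- t))}.
Proof.
apply: continuous_comp; first exact: continuousN.
exact: continuous_expR.
Qed.

Lemma gamma_integrand_continuous s (x : R) : 0 < x ->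
  {for x, continuous (gamma_integrand s)}.
Proof.
move=> x0; apply: continuousM; first exact: continuous_powR_pos.
exact: continuous_expRN.
Qed.

Lemma is_derive_expRM (c x : R) :
  is_derive x 1 (fun t : R => expR (c * t)) (c * expR (c * x)).
Proof.
have h : is_derive x 1 (fun t : R => c * t) c.
  by apply: is_derive_eq; rewrite /GRing.scale/= mulr1.
have := @is_derive1_comp _ expR (fun t : R => c * t) x _ _ _ h.
by move/(_ _ (is_derive_expR _)); rewrite mulrC.
Qed.

Lemma is_derive_powR_expRN s (x : R) : 0 < x ->
  is_derive x 1 (fun t : R => t `^ s * expR (- t))
    (s * gamma_integrand s x - gamma_integrand (s + 1) x).
Proof.
move=> x0.
have h1 : is_derive x 1 (@powR R ^~ s) (s * x `^ (s - 1)) by exact: is_derive1_powR.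
have h2 : is_derive x 1 (fun t : R => expR (- t)) (- expR (- x)).
  rewrite (_ : (fun t => _) = (fun t : R => expR (-1 * t))); last first.
    by apply/funext => t; rewrite mulN1r.
  by have := is_derive_expRM (-1) x; rewrite !mulN1r.
have := is_deriveM h1 h2.
move/is_derive_eq; apply; rewrite /gamma_integrand /GRing.scale/= addrK.
by ring.
Qed.

Lemma gamma_integrand_ge0 s (t : R) : 0 <= gamma_integrand s t.
Proof. by rewrite mulr_ge0 ?powR_ge0 ?expR_ge0. Qed.

Lemma measurable_gamma_integrand s (A : set R) :
  measurable_fun A (fun t => (gamma_integrand s t)%:E).
Proof.
apply/measurable_EFinP/measurable_funTS; apply: measurable_funM.
  exact: measurable_powR.
by apply: measurableT_comp => //; exact: measurable_oppr.
Qed.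

(** Compact intervals that exhaust the half-line and stay away from 0, where the integrand is
    singular for [s < 1]. The shift in the indices makes each one nondegenerate. *)
Let I (n : nat) := `[n.+1%:R^-1 : R, n.+2%:R].

Let Ilt n : n.+1%:R^-1 < n.+2%:R :> R.
Proof.
apply: (@le_lt_trans _ _ 1); first by rewrite invf_le1// ler1n.
by rewrite ltr1n.
Qed.

Let bigcupI : \bigcup_n [set` I n] = `]0, +oo[%classic.
Proof.
apply/seteqP; split => [x [n _]|x]/=.
  by rewrite !in_itv/= andbT => /andP[nx _]; exact: lt_le_trans nx.
rewrite in_itv/= andbT => x0.
have [m xm] : exists m : nat, x <= m%:R.
  by exists (Num.trunc x).+1; exact/ltW/truncnS_gt.
have [k xk] : exists k : nat, x^-1 <= k%:R.
  by exists (Num.trunc x^-1).+1; exact/ltW/truncnS_gt.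
exists (maxn m k) => //=; rewrite in_itv/=; apply/andP; split.
  rewrite -[leRHS]invrK lef_pV2 ?posrE ?invr_gt0//.
  by rewrite (le_trans xk)// ler_nat leqW// leq_maxr.
by rewrite (le_trans xm)// ler_nat !leqW// leq_maxl.
Qed.

Let cvgI s : (\int[mu]_(t in [set` I n]) (gamma_integrand s t)%:E @[n --> \oo]
  --> \int[mu]_(t in `]0%R, +oo[) (gamma_integrand s t)%:E)%E.
Proof.
rewrite -bigcupI; apply: ge0_nondecreasing_set_cvg_integral => //.
- move=> m n mn; rewrite subsetEset; apply: subset_itv; rewrite bnd_simp.
    by rewrite lef_pV2 ?posrE// ler_nat.
  by rewrite ler_nat.
- by move=> n; exact: measurable_gamma_integrand.
- by move=> n x _; rewrite lee_fin gamma_integrand_ge0.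
Qed.

Let finI s n : (\int[mu]_(t in [set` I n]) (gamma_integrand s t)%:E \is a fin_num)%E.
Proof.
apply: integrable_fin_num => //; apply: continuous_compact_integrable.
  exact: segment_compact.
apply: within_continuous_pos => // x x0; exact: gamma_integrand_continuous.
Qed.

(** The derivative of [t ^ s * expR (- t)] is [s] times the integrand minus [t ^ s * expR (- t)],
    and the latter is at most [C * expR (- (t / 2))] by [powR_expRN_le]. Adding a primitive of this
    bound gives [H], whose derivative dominates [s] times the integrand at both ends of the
    half-line. *)
Lemma gamma_integral_fin_num s : 0 < s ->
  (\int[mu]_(t in `]0%R, +oo[) (gamma_integrand s t)%:E \is a fin_num)%E.
Proof.
move=> s0; rewrite ge0_fin_numE; last first.
  by apply: integral_ge0 => x _; rewrite lee_fin gamma_integrand_ge0.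
pose C := (2 * s) `^ s.
have C0 : 0 <= C by exact: powR_ge0.
suff : (\int[mu]_(t in `]0%R, +oo[) (gamma_integrand s t)%:E <= (2 * C / s)%:E)%E.
  by move/le_lt_trans; apply; rewrite ltry.
have cv := cvgI s.
rewrite -(cvg_lim _ cv)//; apply: lime_le; first by apply/cvg_ex; eexists; exact: cv.
apply: nearW => n.
pose H (t : R) := t `^ s * expR (- t) + (- (2 * C)) * expR (- (1 / 2) * t).
pose dH (t : R) := s * gamma_integrand s t - gamma_integrand (s + 1) t
  + (- (2 * C)) * (- (1 / 2) * expR (- (1 / 2) * t)).
have dHE (x : R) : 0 < x -> is_derive x 1 H (dH x).
  move=> x0.
  have h2 : is_derive x 1 (fun t : R => (- (2 * C)) * expR (- (1 / 2) * t))
     ((- (2 * C)) * (- (1 / 2) * expR (- (1 / 2) * x))).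
    have := is_derive_expRM (- (1 / 2)) x.
    by move/(is_deriveZ (- (2 * C))).
  exact: (is_deriveD (is_derive_powR_expRN s _ x0) h2).
have cdH (x : R) : 0 < x -> {for x, continuous dH}.
  move=> x0; apply: continuousD.
    apply: continuousB; last exact: gamma_integrand_continuous.
    by apply: continuousM; [exact: cst_continuous|exact: gamma_integrand_continuous].
  apply: continuousM; first exact: cst_continuous.
  apply: continuousM; first exact: cst_continuous.
  apply: differentiable_continuous; apply/derivable1_diffP.
  by have [] := is_derive_expRM (- (1 / 2)) x.
have dH_ge (x : R) : 0 < x -> s * gamma_integrand s x <= dH x.
  move=> x0; rewrite /dH -addrA lerDl addrC subr_ge0.
  rewrite /gamma_integrand addrK (le_trans (powR_expRN_le _ _ s0 (ltW x0)))//.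
  have -> : - (1 / 2) * x = - (x / 2) by field.
  by rewrite le_eqVlt; apply/orP; left; apply/eqP; rewrite -/C; field.
have Ix (x : R) : [set` I n] x -> 0 < x.
  by rewrite /= in_itv/= => /andP[nx _]; exact: lt_le_trans nx.
have : (\int[mu]_(t in [set` I n]) (s * gamma_integrand s t)%:E <=
        \int[mu]_(t in [set` I n]) (dH t)%:E)%E.
  apply: ge0_le_integral => //.
  - by move=> x _; rewrite lee_fin mulr_ge0 ?gamma_integrand_ge0// ltW.
  - apply/measurable_EFinP; apply: subspace_continuous_measurable_fun => //.
    apply: within_continuous_pos => // x x0.
    by apply: continuousM; [exact: cst_continuous|exact: gamma_integrand_continuous].
  - apply/measurable_EFinP; apply: subspace_continuous_measurable_fun => //.
    exact: within_continuous_pos.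
  - by move=> x /Ix x0; rewrite lee_fin dH_ge.
rewrite (FTC2_pos dH H) // ?Ilt// => /le_trans => bnd.
(* In [H b - H a] the term [b ^ s * expR (- b)] is absorbed by [- 2 * C * expR (- (b / 2))]; what
   remains is at most [2 * C * expR (- (a / 2)) <= 2 * C]. *)
have : (\int[mu]_(t in [set` I n]) (s * gamma_integrand s t)%:E <= (2 * C)%:E)%E.
  apply: bnd; rewrite lee_fin /H.
  set a := n.+1%:R^-1; set b := n.+2%:R.
  have half (x : R) : - (1 / 2) * x = - (x / 2) by field.
  have hb : b `^ s * expR (- b) <= C * expR (- (b / 2)) by apply: powR_expRN_le.
  have ha : 0 <= a `^ s * expR (- a) by rewrite mulr_ge0 ?powR_ge0 ?expR_ge0.
  have ea : expR (- (a / 2)) <= 1 by rewrite expR_le1 oppr_le0 divr_ge0 ?invr_ge0.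
  have eb : 0 <= C * expR (- (b / 2)) by rewrite mulr_ge0 ?expR_ge0.
  have : C * expR (- (a / 2)) <= C by rewrite ler_piMr.
  rewrite !half; lra.
under eq_integral do rewrite EFinM.
rewrite ge0_integralZl_EFin//; last 3 first.
- by move=> x _; rewrite lee_fin gamma_integrand_ge0.
- exact: measurable_gamma_integrand.
- exact: ltW.
rewrite -lee_pdivlMl// => /le_trans; apply.
by rewrite -EFinM lee_fin [in leRHS]mulrC.
Qed.

Lemma GammaE s : 0 < s ->
  ((Gamma s)%:E = \int[mu]_(t in `]0%R, +oo[) (gamma_integrand s t)%:E)%E.
Proof. by move=> s0; rewrite fineK// gamma_integral_fin_num. Qed.

Lemma powR_expRN_cvg_pinfty s : 0 < s ->
  (fun n : nat => n.+2%:R `^ s * expR (- n.+2%:R)) @ \oo --> (0 : R).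
Proof.
move=> s0.
apply: (@squeeze_cvgr _ _ _ _ (cst 0)
  (fun n : nat => (2 * s) `^ s * expR (- (n.+2%:R / 2)))).
- apply: nearW => n /=; rewrite mulr_ge0 ?powR_ge0 ?expR_ge0//=.
  exact: powR_expRN_le.
- exact: cvg_cst.
rewrite -[X in _ --> X](mulr0 ((2 * s) `^ s)).
apply: cvgMr.
have h : (n.+2%:R / 2 : R) @[n --> \oo] --> +oo.
  apply/cvgryPge => A; near=> n.
  rewrite ler_pdivlMr// (@le_trans _ _ n%:R)//; last by rewrite ler_nat !leqW.
  by near: n; exact: nbhs_infty_ger.
exact: (cvg_comp _ _ h (cvgr_expR (R := R))).
Unshelve. all: end_near. Qed.

Lemma powR_expRN_cvg0 s : 0 < s ->
  (fun n : nat => n.+1%:R^-1 `^ s * expR (- n.+1%:R^-1)) @ \oo --> (0 : R).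
Proof.
move=> s0.
have h : (n.+1%:R^-1 : R) @[n --> \oo] --> 0^'+.
  move=> P [e /= e0 eP]; have := near_infty_natSinv_lt (PosNum e0).
  by apply: filterS => n /= ne; apply: eP => //=; rewrite sub0r normrN gtr0_norm.
apply: (@squeeze_cvgr _ _ _ _ (cst 0) (fun n : nat => n.+1%:R^-1 `^ s)).
- apply: nearW => n /=; rewrite mulr_ge0 ?powR_ge0 ?expR_ge0//=.
  by rewrite ler_piMr ?powR_ge0// expR_le1 oppr_le0 invr_ge0.
- exact: cvg_cst.
- exact: (cvg_comp _ (fun a : R => a `^ s) h (powR_cvg0 s0)).
Qed.

(** Integration by parts on each [I n]; the two boundary terms vanish in the limit. *)
Lemma Gamma_rec s : 0 < s -> Gamma (s + 1) = s * Gamma s.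
Proof.
move=> s0.
have s10 : 0 < s + 1 by rewrite addr_gt0.
pose F (t : R) := t `^ s * expR (- t).
have intI r n : mu.-integrable [set` I n] (fun t => (gamma_integrand r t)%:E).
  apply: continuous_compact_integrable; first exact: segment_compact.
  apply: within_continuous_pos => // x x0; exact: gamma_integrand_continuous.
have h n : (\int[mu]_(t in [set` I n]) (gamma_integrand (s + 1) t)%:E =
  s%:E * \int[mu]_(t in [set` I n]) (gamma_integrand s t)%:E -
  (F n.+2%:R - F n.+1%:R^-1)%:E)%E.
  have <- : (\int[mu]_(t in [set` I n])
      (s * gamma_integrand s t - gamma_integrand (s + 1) t)%:E =
      (F n.+2%:R - F n.+1%:R^-1)%:E)%E.
    apply: FTC2_pos => //.
    - by move=> x x0; exact: is_derive_powR_expRN.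
    - move=> x x0; apply: continuousB; last exact: gamma_integrand_continuous.
      by apply: continuousM; [exact: cst_continuous|exact: gamma_integrand_continuous].
  under [X in _ = (_ - X)%E]eq_integral do rewrite EFinB EFinM.
  rewrite integralB//=; last exact: integrableZl.
  rewrite integralZl// -(fineK (finI s n)) -(fineK (finI (s + 1) n)).
  by rewrite -!EFinM -!EFinB; congr EFin; ring.
have l1 := cvgI (s + 1).
have l2 : (s%:E * \int[mu]_(t in [set` I n]) (gamma_integrand s t)%:E -
  (F n.+2%:R - F n.+1%:R^-1)%:E)%E @[n --> \oo] --> (s * Gamma s - (0 - 0))%:E.
  rewrite EFinB EFinM GammaE//; apply: cvgeB.
  - by rewrite fin_num_adde_defl.
  - by apply: cvgeZl => //; exact: cvgI.
  - apply: cvg_EFin; first exact: nearW.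
    by apply: cvgB; [exact: powR_expRN_cvg_pinfty|exact: powR_expRN_cvg0].
apply: EFin_inj; rewrite GammaE// -(cvg_lim _ l1)//.
under eq_fun do rewrite h.
by rewrite (cvg_lim _ l2)// subrr subr0.
Qed.

Lemma Gamma_gt0 s : 0 < s -> 0 < Gamma s.
Proof.
move=> s0; rewrite -lte_fin GammaE//.
(* A lower bound of the integrand on [1, 2]: there [t ^ (s - 1) >= 1 / t >= 1 / 2] because
   [t ^ s >= 1]. *)
pose c : R := 2^-1 * expR (- 2).
have c0 : 0 < c by rewrite mulr_gt0 ?expR_gt0.
have I12 : [set` `[1 : R, 2]] `<=` `]0, +oo[.
  by move=> x /=; rewrite !in_itv/= andbT => /andP[x1 _]; exact: lt_le_trans x1.
have h1 : (0 < \int[mu]_(t in `[1%R, 2%R]) c%:E)%E.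
  rewrite integral_cst//= lebesgue_measure_itv/= lte_fin ltr1n -EFinB -EFinM lte_fin.
  by rewrite mulr_gt0// subr_gt0 ltr1n.
have h2 : (\int[mu]_(t in `[1%R, 2%R]) c%:E <=
    \int[mu]_(t in `[1%R, 2%R]) (gamma_integrand s t)%:E)%E.
  apply: ge0_le_integral => //.
  - by move=> x _; rewrite lee_fin ltW.
  - exact: measurable_gamma_integrand.
  - move=> x /=; rewrite in_itv/= => /andP[x1 x2].
    have x0 : 0 < x by exact: lt_le_trans x1.
    rewrite lee_fin /gamma_integrand ler_pM ?expR_ge0 ?invr_ge0//.
      rewrite -(ler_pM2l x0) mulr_powRB1 ?(ltW x0)//.
      apply: (@le_trans _ _ 1); first by rewrite ler_pdivrMr// mul1r.
      by rewrite -[leLHS](powRr0 x); apply: ler_powR => //; exact: ltW.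
    by rewrite ler_expR lerN2.
apply: (lt_le_trans h1); apply: (le_trans h2); apply: ge0_subset_integral => //.
- exact: measurable_gamma_integrand.
- by move=> x _; rewrite lee_fin gamma_integrand_ge0.
Qed.

End GammaFunction.

(** * Entire series and the Bessel equation *)

Section EntireSeries.
Context {R : realType}.
Implicit Types (a : R^nat) (x C K : R).

(** Domination by the coefficients of [C * expR (K * x)]: it gives convergence everywhere and is
    stable under termwise differentiation. *)
Definition fact_bounded a :=
  exists C K, 0 <= K /\ forall n, `|a n| <= C * (K ^+ n / n`!%:R).

Lemma fact_bounded_diffs a : fact_bounded a -> fact_bounded (pseries_diffs a).
Proof.
move=> [C [K [K0 aCK]]]; exists (C * K), K; split => // n.
rewrite /pseries_diffs normrM ger0_norm// -ler_pdivlMl//.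
apply: (le_trans (aCK n.+1)); rewrite le_eqVlt; apply/orP; left; apply/eqP.
rewrite exprS factS natrM; field.
by rewrite pnatr_eq0 -lt0n fact_gt0 /= nat1r pnatr_eq0.
Qed.

Lemma fact_bounded_cvg a x : fact_bounded a -> cvgn (pseries a x).
Proof.
move=> [C [K [K0 aCK]]]; apply: normed_cvg.
have le n : `|a n * x ^+ n| <= C * exp_coeff (K * `|x|) n.
  rewrite normrM normrX /exp_coeff/= exprMn.
  apply: (@le_trans _ _ (C * (K ^+ n / n`!%:R) * `|x| ^+ n)).
    by rewrite ler_wpM2r ?exprn_ge0.
  by rewrite le_eqVlt; apply/orP; left; apply/eqP; ring.
apply: (series_le_cvg _ _ le) => [//|n|]; first exact: le_trans (le n).
apply: is_cvg_seriesZ.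
exact: is_cvg_series_exp_coeff.
Qed.

Lemma fact_bounded_is_derive a x : fact_bounded a ->
  is_derive x 1 (fun t => limn (pseries a t)) (limn (pseries (pseries_diffs a) x)).
Proof.
move=> ba; apply: (@pseries_snd_diffs _ a (`|x| + 1)).
- exact: fact_bounded_cvg.
- by apply: fact_bounded_cvg; exact: fact_bounded_diffs.
- by apply: fact_bounded_cvg; do 2 apply: fact_bounded_diffs.
- by rewrite [ltRHS]ger0_norm ?addr_ge0// ltrDl.
Qed.

(** The coefficient of [x ^ n] on the left is [(n + 1) * (n + m) * a (n + 1) + a n / 4], which the
    recurrence cancels. *)
Lemma pseries_ode (m : R) a x : fact_bounded a ->
  (forall n, n.+1%:R * (n%:R + m) * a n.+1 = - (a n / 4)) ->
  x * limn (pseries (pseries_diffs (pseries_diffs a)) x)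
  + m * limn (pseries (pseries_diffs a) x) + limn (pseries a x) / 4 = 0.
Proof.
move=> ba arec.
have b1 := fact_bounded_diffs _ ba; have b2 := fact_bounded_diffs _ b1.
have c0 := fact_bounded_cvg _ x ba.
have c1 := fact_bounded_cvg _ x b1.
(* This writes the second derivative with terms in [x ^ i.-1]; after multiplication by [x] the three
   series align term by term, so that every partial sum is 0. *)
have c2 := pseries_diffs_equiv (fact_bounded_cvg _ x b2).
set s := (fun i => _) in c2.
have c : (fun n => x * series s n + m * pseries (pseries_diffs a) x n + pseries a x n / 4)
    @ \oo --> x * limn (pseries (pseries_diffs (pseries_diffs a)) x)
  + m * limn (pseries (pseries_diffs a) x) + limn (pseries a x) / 4.
  by apply: cvgD; [apply: cvgD|]; [apply: cvgMr|apply: cvgMr|apply: cvgMl].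
rewrite -(cvg_lim _ c)//.
rewrite (_ : (fun _ => _) = cst 0) ?lim_cst//.
apply/funext => n /=; rewrite /pseries /series/= !mulr_sumr mulr_suml -!big_split/=.
apply: big1 => i _; rewrite /s.
have -> : x * (i%:R * pseries_diffs a i * x ^+ i.-1) = i%:R * pseries_diffs a i * x ^+ i.
  by case: i => [|i]; [rewrite !mul0r mulr0|rewrite /= exprS mulrCA].
rewrite /pseries_diffs.
transitivity ((i.+1%:R * (i%:R + m) * a i.+1 + a i / 4) * x ^+ i); first by ring.
by rewrite arec addNr mul0r.
Qed.

End EntireSeries.

(** * Energy growth and unbounded solutions *)

Section EnergyGrowth.
Context {R : realType}.
Variables (m : R) (h h1 h2 : R -> R).
Hypotheses (m_gt0 : 0 < m) (m_lt : m < 2^-1).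
Hypothesis dh : forall x : R, is_derive x 1 h (h1 x).
Hypothesis dh1 : forall x : R, is_derive x 1 h1 (h2 x).
Hypothesis ode : forall x, x * h2 x + m * h1 x + h x / 4 = 0.
Hypothesis h0 : h 0 != 0.

Lemma is_derive_continuous (f : R -> R) (x df : R) :
  is_derive x 1 f df -> {for x, continuous f}.
Proof.
by case=> df1 _; apply: differentiable_continuous; exact/derivable1_diffP.
Qed.

Lemma is_derive_ndecr (f df : R -> R) (a : R) :
  (forall x : R, a <= x -> is_derive x 1 f (df x)) ->
  (forall x : R, a <= x -> 0 <= df x) ->
  forall x y, a <= x -> x <= y -> f x <= f y.
Proof.
move=> fdf df0; apply: ger0_derive1_ndecry.
- by move=> x; rewrite in_itv/= andbT => /ltW/fdf[].
- move=> x; rewrite in_itv/= andbT => /ltW ax; rewrite derive1E.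
  by have [_ ->] := fdf _ ax; exact: df0.
- apply: continuous_in_subspaceT => x; rewrite inE/= in_itv/= andbT => ax.
  exact: is_derive_continuous (fdf _ ax).
Qed.

(** With [h x = f (Num.sqrt x)] the equation reads [f'' + f = (c / s) * f'] at [s = Num.sqrt x]:
    positive [c] is a negative friction, which feeds energy into the oscillation. *)
Let c := 1 - 2 * m.

Let c_gt0 : 0 < c. Proof. by rewrite /c; move: m_lt; lra. Qed.

(* If h x = f (Num.sqrt x), this is f^2 + f'^2 at Num.sqrt x. *)
Definition energy (x : R) := h x ^+ 2 + 4 * x * h1 x ^+ 2.

Lemma is_derive_energy (x : R) : is_derive x 1 energy (4 * c * h1 x ^+ 2).
Proof.
rewrite /energy; apply: is_derive_eq.
rewrite /GRing.scale/=.
have := ode x; rewrite /c; move: (h x) (h1 x) (h2 x) => u v w o.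
have xw : x * w = - (m * v + u / 4) by lra.
transitivity (2 * u * v + 8 * v * (x * w) + 4 * v ^+ 2); first by ring.
by rewrite xw; field.
Qed.

Lemma energy_ndecr x y : 0 <= x -> x <= y -> energy x <= energy y.
Proof.
move=> x0 xy.
apply: (@is_derive_ndecr energy (fun x => 4 * c * h1 x ^+ 2) 0) => // z _.
  exact: is_derive_energy.
by rewrite mulr_ge0 ?sqr_ge0// mulr_ge0// ltW.
Qed.

Let e0 := h 0 ^+ 2.

Let e0_gt0 : 0 < e0. Proof. by rewrite exprn_even_gt0. Qed.

Lemma energy_ge (x : R) : 0 <= x -> e0 <= energy x.
Proof.
move=> x0; have := energy_ndecr _ _ (lexx 0) x0.
by rewrite {1}/energy mulr0 mul0r addr0.
Qed.

Lemma energy_unbounded (A : R) : exists2 x, 16 <= x & A <= energy x.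
Proof.
(* By [energy_ge], [k] is a lower bound of [c / 4 * energy x]. *)
pose k := c * e0 / 4.
have k0 : 0 < k by rewrite /k divr_gt0// mulr_gt0.
(* 2 c h h1 exchanges half of the kinetic part of the derivative of the energy
   for a potential one, so that x * dF x >= c / 4 * energy x - k. *)
pose F (x : R) := energy x - 2 * c * (h x * h1 x) - k * ln x.
pose dF (x : R) := 4 * c * h1 x ^+ 2 - 2 * c * (h1 x ^+ 2 + h x * h2 x) - k * x^-1.
have dFE (z : R) : 16 <= z -> is_derive z 1 F (dF z).
  move=> z16; have z0 : 0 < z by exact: lt_le_trans z16.
  have dln := is_derive1_ln z0.
  have den := is_derive_energy z.
  by apply: is_derive_eq; rewrite /dF /GRing.scale/=; ring.
have dF_ge0 (z : R) : 16 <= z -> 0 <= dF z.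
  move=> z16; have z0 : 0 < z by exact: lt_le_trans z16.
  rewrite -(pmulr_rge0 _ z0) /dF.
  have ez := energy_ge _ (ltW z0).
  have -> : z * (4 * c * h1 z ^+ 2 - 2 * c * (h1 z ^+ 2 + h z * h2 z) - k * z^-1) =
    c * (2 * (z * h1 z ^+ 2) - 2 * h z * (z * h2 z)) - k * (z * z^-1) by ring.
  rewrite divff ?gt_eqF// mulr1 /k.
  have -> : z * h2 z = - (m * h1 z + h z / 4) by move: (ode z); lra.
  rewrite -[X in _ - X]mulrA -mulrBr mulr_ge0 ?(ltW c_gt0)//.
  have -> : 2 * (z * h1 z ^+ 2) - 2 * h z * - (m * h1 z + h z / 4) - e0 / 4 =
    (h z / 2 + 2 * m * h1 z) ^+ 2 + (z - 4 * m ^+ 2) * h1 z ^+ 2 +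
    (energy z - e0) / 4 by rewrite /energy; field.
  rewrite addr_ge0 ?divr_ge0 ?subr_ge0// addr_ge0 ?sqr_ge0// mulr_ge0 ?sqr_ge0//.
  by rewrite subr_ge0; move: m_gt0 m_lt z16; nra.
have Fnd (x : R) : 16 <= x -> F 16 <= F x.
  exact: (is_derive_ndecr F dF 16 dFE dF_ge0 16 x (lexx _)).
(* At [x >= expR t] one has [2 * A <= F 16 + k * ln x <= energy x - 2 * c * (h x * h1 x)], and
   completing a square bounds the right side by [2 * energy x]. *)
pose t := (2 * A - F 16) / k.
have x16 : 16 <= 16 + expR t by rewrite lerDl expR_ge0.
exists (16 + expR t) => //.
have := Fnd _ x16; rewrite {2}/F; set x := 16 + expR t.
have x0 : 0 < x by exact: lt_le_trans x16.
have tx : k * t <= k * ln x.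
  by rewrite ler_pM2l// -[leLHS]expRK ler_ln ?posrE ?expR_gt0// /x lerDr.
have kt : k * t = 2 * A - F 16 by rewrite /t; field; rewrite gt_eqF.
have : 0 <= energy x + 2 * c * (h x * h1 x).
  have -> : energy x + 2 * c * (h x * h1 x) =
    (h x + c * h1 x) ^+ 2 + (4 * x - c ^+ 2) * h1 x ^+ 2 by rewrite /energy; ring.
  rewrite addr_ge0 ?sqr_ge0// mulr_ge0 ?sqr_ge0// subr_ge0 /c.
  by move: m_gt0 m_lt x16; rewrite -/x; nra.
by rewrite kt in tx; lra.
Qed.

Lemma ode_solution_unbounded (M : R) : exists2 x : R, 0 < x & M < `|h x|.
Proof.
apply: contrapT => hM.
have {}hM (x : R) : 0 < x -> `|h x| <= M.
  by move=> x0; rewrite leNgt; apply/negP => Mx; apply: hM; exists x.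
have M0 : 0 <= M by apply: le_trans (hM 1 _).
(* Once the energy is large, h bounded makes h1 large, and the mean value theorem
   on [x, 2 x] contradicts the bound on h. *)
have [x x16 Ax] := energy_unbounded (M ^+ 2 + (2 * M ^+ 2 + 1)).
have x0 : 0 < x by exact: lt_le_trans x16.
have xx2 : x < 2 * x by rewrite mulr_natl mulr2n ltrDl.
have ch : {within `[x, 2 * x], continuous h}.
  by apply: continuous_subspaceT => y; exact: is_derive_continuous (dh y).
have [z zx hz] := MVT xx2 (fun y _ => dh y) ch.
move: zx; rewrite in_itv/= => /andP[xz zx].
have z0 : 0 < z by exact: lt_trans xz.
have Ez : M ^+ 2 + (2 * M ^+ 2 + 1) <= energy z.
  by apply: (le_trans Ax); apply: energy_ndecr; exact: ltW.
have sqle (t : R) : 0 < t -> h t ^+ 2 <= M ^+ 2.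
  by move=> t0; rewrite -real_normK ?num_real// lerXn2r ?nnegrE ?hM.
have h4 : (h (2 * x) - h x) ^+ 2 <= 4 * M ^+ 2.
  have := sqle _ x0; have := sqle (2 * x); rewrite mulr_gt0// => /(_ isT).
  by have := sqr_ge0 (h (2 * x) + h x); rewrite !expr2; lra.
have hz2 := sqle _ z0; move: Ez h4; rewrite hz /energy => Ez.
have -> : 2 * x - x = x by ring.
have h1z : 2 * M ^+ 2 + 1 <= 8 * x * h1 z ^+ 2.
  apply: (@le_trans _ _ (4 * z * h1 z ^+ 2)); first by lra.
  by rewrite ler_wpM2r ?sqr_ge0//; lra.
(* Since [x / 8 >= 2], the squared increment of [h] over [x, 2 x] is at least [4 * M ^+ 2 + 2],
   against the bound [h4]. *)
have : 2 * (2 * M ^+ 2 + 1) <= h1 z ^+ 2 * x ^+ 2.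
  apply: (@le_trans _ _ (x / 8 * (8 * x * h1 z ^+ 2))); last first.
    by rewrite le_eqVlt; apply/orP; left; apply/eqP; field.
  by apply: ler_pM => //; [rewrite addr_ge0// mulr_ge0// sqr_ge0|lra].
by rewrite exprMn; lra.
Qed.

End EnergyGrowth.

(** * Gliding hump *)

Section SumOfIntegrable.
Context d (T : measurableType d) (R : realType).
Variables (mu : {measure set T -> \bar R}) (D : set T).
Hypothesis mD : measurable D.

(** Monotone convergence makes the sum integrable, hence finite almost everywhere; dominated
    convergence with majorant [C * g] then handles each bounded weight. The function [g] is chosen
    before [w], so one [g] serves all frequencies. *)
Lemma integrable_sum_functions (h : (T -> R)^nat) (B : R) :
  (forall n x, D x -> 0 <= h n x) ->
  (forall n, mu.-integrable D (EFin \o h n)) ->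
  (forall n, \sum_(k < n) \int[mu]_(x in D) h k x <= B) ->
  exists g : T -> R, mu.-integrable D (EFin \o g) /\
    forall (w : T -> R) (C : R), measurable_fun D w ->
      (forall x, D x -> `|w x| <= C) ->
      (fun n => \sum_(k < n) \int[mu]_(x in D) (w x * h k x)) @ \oo -->
      \int[mu]_(x in D) (w x * g x).
Proof.
move=> h0 ih hB.
pose G x : \bar R := (\sum_(k <oo) (h k x)%:E)%E.
have mh n : measurable_fun D (h n) by exact/measurable_EFinP/(measurable_int _ (ih n)).
have mG : measurable_fun D G.
  apply: ge0_emeasurable_sum => //.
  - by move=> k x Dx _; rewrite lee_fin h0.
  - by move=> k _; exact: measurable_int (ih k).
have iG : mu.-integrable D G.
  apply/integrableP; split => //.
  have -> : (\int[mu]_(x in D) `|G x| = \int[mu]_(x in D) G x)%E.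
    apply: eq_integral => x; rewrite inE => Dx; rewrite gee0_abs//.
    by apply: nneseries_ge0 => k _ _; rewrite lee_fin h0.
  rewrite integral_nneseries//; last first.
  - by move=> n; exact: measurable_int (ih n).
  apply: (@le_lt_trans _ _ B%:E); last by rewrite ltry.
  apply: lime_le.
    apply: is_cvg_nneseries => n _ _; apply: integral_ge0 => x Dx.
    by rewrite lee_fin h0.
  apply: nearW => n.
  apply: le_trans (_ : (\sum_(k < n) \int[mu]_(x in D) h k x)%:E <= _)%E;
    last by rewrite lee_fin.
  rewrite big_mkord -sumEFin le_eqVlt; apply/orP; left; apply/eqP.
  by apply: eq_bigr => k _; rewrite /Rintegral fineK//; exact: (integrable_fin_num mD (ih k)).
(* [fine] sends an infinite sum to 0, which happens only on a null set. *)
pose g x := fine (G x).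
have mg : measurable_fun D g by exact: measurableT_comp.
have ig : mu.-integrable D (EFin \o g).
  apply: le_integrable iG => //; first exact/measurable_EFinP.
  by move=> x Dx; rewrite /g/=; case: (G x) => [r| |]//=; rewrite ?normr0 leey.
exists g; split => // w C mw wC.
pose f_ n x := (w x * \sum_(k < n) h k x)%:E.
have mf_ n : measurable_fun D (f_ n).
  apply/measurable_EFinP; apply: measurable_funM => //.
  by apply: measurable_sum => k; exact: mh.
have mf : measurable_fun D (fun x => (w x * g x)%:E).
  by apply/measurable_EFinP; exact: measurable_funM.
have fin := integrable_ae mD iG.
have Gge x n : D x -> ((\sum_(k < n) h k x)%:E <= G x)%E.
  move=> Dx; rewrite -sumEFin -(big_mkord xpredT (fun k => (h k x)%:E)).
  by apply: nneseries_lim_ge => k _; rewrite lee_fin h0.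
have ifw (u : T -> R) : mu.-integrable D (EFin \o u) ->
    mu.-integrable D (fun x => (w x * u x)%:E).
  move=> iu; apply: (le_integrable mD _ _ (integrableZl mD C iu)).
    apply/measurable_EFinP; apply: measurable_funM => //.
    exact/measurable_EFinP/(measurable_int _ iu).
  move=> x Dx; rewrite /= lee_fin !normrM ler_wpM2r// (le_trans (wC x Dx))//.
  exact: ler_norm.
have key : (\int[mu]_(x in D) f_ n x)%E @[n --> \oo] -->
    (\int[mu]_(x in D) (w x * g x)%:E)%E.
  have [] // := @dominated_convergence _ T R mu D mD f_ (fun x => (w x * g x)%:E)
    (fun x => (C * g x)%:E) mf_ mf.
  - apply: filterS fin => x Gx Dx; rewrite /f_ EFinM /g fineK; last exact: Gx.
    under eq_fun do rewrite EFinM -sumEFin -(big_mkord xpredT (fun k => (h k x)%:E)).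
    apply: cvgeZl => //; apply: is_cvg_nneseries => k _ _.
    by rewrite lee_fin h0.
  - by under eq_fun do rewrite EFinM; exact: integrableZl.
  - apply: filterS fin => x Gx n Dx.
    rewrite lee_fin normrM ler_pM ?wC//.
    rewrite ger0_norm; last by apply: sumr_ge0 => k _; exact: h0.
    by rewrite -lee_fin /g (fineK (Gx Dx)) Gge.
have -> : (fun n => \sum_(k < n) \int[mu]_(x in D) (w x * h k x)) =
    fine \o (fun n => \int[mu]_(x in D) f_ n x)%E.
  apply/funext => n /=; rewrite /f_.
  under eq_integral do rewrite mulr_sumr -sumEFin.
  rewrite integral_sum//; last by move=> k; exact: ifw.
  rewrite [RHS](_ : _ = fine (\sum_(k < n) \int[mu]_(x in D) (w x * h k x))%:E)//.
  congr fine; rewrite -sumEFin; apply: eq_bigr => k _.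
  by rewrite /Rintegral fineK//; apply: integrable_fin_num => //; exact: ifw.
apply: fine_cvg; rewrite /Rintegral fineK//.
by apply: integrable_fin_num => //; exact: ifw.
Qed.

End SumOfIntegrable.

Section GlidingHump.
Context {R : realType}.
Local Notation mu := (@lebesgue_measure R).
Local Notation D := `]0 : R, 1[%classic.
Implicit Types (w Phi g b : R -> R).

Lemma continuous_bounded_itv w (a c : R) : continuous w ->
  exists2 B : R, 0 <= B & forall x, a <= x <= c -> `|w x| <= B.
Proof.
move=> cw; have [ac|ca] := leP a c; last first.
  by exists 0 => // x /andP[ax xc]; move: (le_trans ax xc); rewrite leNgt ca.
have cn : {within `[a, c], continuous (fun x => `|w x|)}.
  apply: continuous_subspaceT => x.
  by apply: continuous_comp; [exact: cw|exact: norm_continuous].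
have [z _ zmax] := EVT_max ac cn.
by exists `|w z| => // x axc; apply: zmax; rewrite in_itv.
Qed.

Lemma continuous_measurable_funTS w (A : set R) : continuous w -> measurable_fun A w.
Proof. by move=> cw; apply: measurable_funTS; exact: continuous_measurable_fun. Qed.

Lemma integrable_continuousM w g : continuous w -> mu.-integrable D (EFin \o g) ->
  mu.-integrable D (EFin \o (fun x => w x * g x)).
Proof.
move=> cw ig; have [B B0 wB] := continuous_bounded_itv w 0 1 cw.
apply: (le_integrable _ _ _ (integrableZl _ B ig)) => //.
  apply/measurable_EFinP; apply: measurable_funM.
    exact: continuous_measurable_funTS.
  by apply/measurable_EFinP; exact: (measurable_int mu).
move=> x; rewrite /= in_itv/= => /andP[x0 x1].
rewrite lee_fin !normrM ler_wpM2r// (le_trans (wB x _))// ?ler_norm//.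
by rewrite !ltW.
Qed.

(** The hump is the normalized indicator of a short interval starting at 1/2, on which [w] still
    exceeds [K] by continuity. *)
Lemma exists_hump w (K : R) : continuous w -> 0 <= K -> K < w 2^-1 ->
  exists b, [/\ forall x, 0 <= b x, mu.-integrable D (EFin \o b),
    \int[mu]_(x in D) b x = 1 & K <= \int[mu]_(x in D) (w x * b x)].
Proof.
move=> cw K0 Kw.
have [e /= e0 eK] := cvgr_gt _ (cw 2^-1) _ Kw.
(* [e / 2] keeps the closed interval in the open ball of radius [e], and [4^-1] keeps it in ]0,
   1[. *)
pose r : R := Num.min (e / 2) 4^-1.
have r0 : 0 < r by rewrite lt_min divr_gt0//= invr_gt0.
have r4 : r <= 4^-1 by rewrite ge_min lexx orbT.
have re : r < e.
  by rewrite gt_min ltr_pdivrMr// ltr_pMr// ltr1n.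
pose I : set R := `[2^-1 : R, 2^-1 + r]%classic.
have mI : measurable I by exact: measurable_itv.
have ID : I `<=` D.
  by move=> x; rewrite /I /= !in_itv/= => /andP[x0 x1]; apply/andP; split; lra.
have muI : mu I = r%:E.
  rewrite /I lebesgue_measure_itv/= lte_fin ltrDl r0 -EFinB; congr EFin; ring.
pose b x := r^-1 * \1_I x.
have i1 : mu.-integrable D (EFin \o \1_I).
  apply: (@integrableS _ _ _ mu setT) => //.
  exact: integrable_indic_itv.
have ib : mu.-integrable D (EFin \o b) by exact: (integrableZl _ r^-1 i1).
have b0 x : 0 <= b x by rewrite mulr_ge0 ?invr_ge0 ?(ltW r0)// indicE.
have intb : \int[mu]_(x in D) b x = 1.
  rewrite RintegralZl// /Rintegral integral_indic//.
  rewrite [X in fine X](_ : _ = r%:E)/=; last by rewrite (setIidl ID); exact: muI.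
  by rewrite mulVf// gt_eqF.
exists b; split => //.
have -> : K = \int[mu]_(x in D) (K * b x) by rewrite RintegralZl// intb mulr1.
apply: le_Rintegral => //.
- exact: (integrableZl _ K ib).
- exact: integrable_continuousM.
move=> x _; rewrite /b indicE; case: (boolP (x \in I)) => [|_]; last by rewrite !mulr0.
rewrite inE /I/= in_itv/= => /andP[x0 x1].
rewrite ler_wpM2r ?mulr1 ?invr_ge0 ?(ltW r0)//; apply/ltW/eK => /=.
by rewrite distrC ger0_norm ?subr_ge0//; lra.
Qed.

Variable Phi : R -> R.
Hypothesis cPhi : continuous Phi.
Hypothesis Phi_unbounded : forall M : R, exists2 t : R, 0 < t & M < `|Phi t|.

Let S (y : R) g := \int[mu]_(x in D) (Phi (x * y) * g x).

Hypothesis S_cvg0 : forall g, mu.-integrable D (EFin \o g) ->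
  S y g @[y --> +oo] --> (0 : R).

Let cPhiM (y : R) : continuous (fun x : R => Phi (x * y)).
Proof.
move=> x; apply: (@continuous_comp _ _ _ (fun x : R => x * y) Phi); last exact: cPhi.
by apply: continuousM; [exact: cvg_id|exact: cst_continuous].
Qed.

Let S_le (y B : R) b : mu.-integrable D (EFin \o b) -> (forall x, 0 <= b x) -> 0 <= y ->
  (forall t, 0 <= t <= y -> `|Phi t| <= B) -> `|S y b| <= B * \int[mu]_(x in D) b x.
Proof.
move=> ib b0 y0 PB.
apply: le_trans (le_normr_Rintegral _ _) _ => //; first exact: integrable_continuousM.
rewrite -RintegralZl//; apply: le_Rintegral => //.
- exact: (integrable_norm (integrable_continuousM _ _ (cPhiM y) ib)).
- exact: (integrableZl _ B ib).
move=> x /=; rewrite in_itv/= => /andP[x0 x1].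
rewrite normrM (ger0_norm (b0 x)) ler_wpM2r// PB// mulr_ge0 ?(ltW x0)//=.
by rewrite ler_piMl// ltW.
Qed.

(** A point [t] where [Phi] exceeds both [K] and its bound on [0, N] must lie beyond [N]. The
    frequency [2 * t] brings [t] to the midpoint [x = 1/2], where [exists_hump] applies to [Phi] or
    to its opposite. *)
Let far_hump (N K : R) : 0 < K ->
  exists y b, [/\ N <= y, forall x, 0 <= b x, mu.-integrable D (EFin \o b),
    \int[mu]_(x in D) b x = 1 & K <= `|S y b|].
Proof.
move=> K0; have [B B0 PB] := continuous_bounded_itv Phi 0 N cPhi.
have [t t0 Bt] := Phi_unbounded (Num.max B K).
move: Bt; rewrite gt_max => /andP[Bt Kt].
have Nt : N < t.
  rewrite ltNge; apply/negP => tN.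
  by move: (PB t); rewrite (ltW t0) tN => /(_ isT); rewrite leNgt Bt.
have half : 2^-1 * (2 * t) = t by rewrite mulrA mulVf ?mul1r.
have N2t : N <= 2 * t by lra.
have [Pt|Pt] := leP 0 (Phi t).
- have [|b [b0 ib b1 Kb]] := @exists_hump (fun x : R => Phi (x * (2 * t))) K (cPhiM _) (ltW K0).
    by rewrite half; rewrite ger0_norm// in Kt.
  by exists (2 * t), b; split => //; exact: le_trans (ler_norm _).
- have cN : continuous (fun x : R => - Phi (x * (2 * t))).
    by move=> x; apply: continuousN; exact: cPhiM.
  have [|b [b0 ib b1 Kb]] := @exists_hump (fun x : R => - Phi (x * (2 * t))) K cN (ltW K0).
    by rewrite half; rewrite ltr0_norm// in Kt.
  exists (2 * t), b; split => //; rewrite -normrN; apply: le_trans (ler_norm _).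
  apply: (le_trans Kb); rewrite le_eqVlt; apply/orP; left; apply/eqP.
  rewrite /S -mulN1r -RintegralZl//; last exact: integrable_continuousM.
  by apply: eq_Rintegral => x _; rewrite mulN1r mulNr.
Qed.

(* Given the sum G of the previous humps and the frequency y used last, the new
   hump b dominates G at a larger frequency y', and is too small to matter at any
   frequency up to y. *)
Let step_spec (k : nat) (G : R -> R) (y : R) (b : R -> R) (y' : R) :=
  [/\ forall x, 0 <= b x, mu.-integrable D (EFin \o b), y + 1 <= y',
      `|S y' G| <= 1 & 3 <= `|S y' b|] /\
  [/\ \int[mu]_(x in D) b x <= 2^-1 ^+ k.+1 &
      forall t, 0 <= t <= y -> `|S t b| <= 2^-1 ^+ k.+1].

Let step k G y : mu.-integrable D (EFin \o G) -> 0 <= y ->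
  exists b y', step_spec k G y b y'.
Proof.
move=> iG y0.
have [B B0 PB] := continuous_bounded_itv Phi 0 y cPhi.
(* Scaling a hump of mass 1 by [c] makes both its mass and its response up to frequency [y], at most
   [B * c], small enough. The threshold [3 / c] below compensates for this scaling at [y']. *)
pose c : R := 2^-1 ^+ k.+1 / (1 + B).
have B1 : 0 < 1 + B by rewrite ltr_pwDl.
have c0 : 0 < c by rewrite divr_gt0// exprn_gt0.
have cE : c * (1 + B) = 2^-1 ^+ k.+1 by rewrite /c divfK// gt_eqF.
have ck : c <= 2^-1 ^+ k.+1 by rewrite -cE ler_peMr ?(ltW c0)// lerDl.
have [N [_ NG]] := cvgr0_norm_le _ (S_cvg0 _ iG) _ (@ltr01 R).
have [|y' [b [Ny' b0 ib b1 Kb]]] := @far_hump (Num.max (y + 1) (N + 1)) (3 / c).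
  by rewrite divr_gt0.
move: Ny'; rewrite ge_max => /andP[yy' Ny'].
have Sc t : S t (fun x => c * b x) = c * S t b.
  rewrite /S -RintegralZl//; last exact: integrable_continuousM.
  by apply: eq_Rintegral => x _; ring.
have ic : mu.-integrable D (EFin \o (fun x => c * b x)).
  exact: (integrableZl _ c ib).
have intc : \int[mu]_(x in D) (c * b x) = c by rewrite RintegralZl// b1 mulr1.
exists (fun x => c * b x), y'; split; split => //.
- by move=> x; rewrite mulr_ge0// ltW.
- by apply: NG; apply: lt_le_trans Ny'; rewrite ltrDl.
- by rewrite Sc normrM gtr0_norm// -ler_pdivrMl// mulrC.
- by rewrite intc.
move=> t /andP[t0 ty].
apply: (@le_trans _ _ (B * \int[mu]_(x in D) (c * b x))).
  apply: S_le => //; first by move=> x; rewrite mulr_ge0// ltW.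
  by move=> s /andP[s0 st]; apply: PB; rewrite s0 (le_trans st).
by rewrite intc -cE mulrC ler_wpM2l ?(ltW c0)// lerDr.
Qed.

(** Let [g] be the sum of all humps. At the frequency of one hump the earlier ones contribute at
    most 1, that hump at least 3, and the later ones at most a geometric tail, so the response to
    [g] is at least 1 along frequencies tending to infinity. *)
Lemma unbounded_kernel_not_cvg0 : False.
Proof.
(* The conditions on the state sit under the existential, so that choice gives a total function;
   [inv] discharges them along the recursion. *)
have /choice[F FP] : forall s : nat * ((R -> R) * R), exists s' : (R -> R) * R,
    mu.-integrable D (EFin \o s.2.1) -> 0 <= s.2.2 ->
    step_spec s.1 s.2.1 s.2.2 s'.1 s'.2.
  move=> [k [G y]] /=.
  have [[iG y0]|no] := pselect (mu.-integrable D (EFin \o G) /\ 0 <= y).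
    by have [b [y' h]] := step k _ _ iG y0; exists (b, y').
  by exists (G, y) => iG y0; exfalso; apply: no.
pose next k (s : (R -> R) * R) := (fun x => s.1 x + (F (k, s)).1 x, (F (k, s)).2).
pose st := fix st k := if k is k'.+1 then next k' (st k') else (cst 0 : R -> R, 0 : R).
(* Hump [b k] is tuned to the frequency [y k.+1], and [G k] sums only the humps before it. *)
pose b k := (F (k, st k)).1.
pose y k := (st k).2.
pose G k := (st k).1.
have GS k x : G k.+1 x = G k x + b k x by [].
have inv k : mu.-integrable D (EFin \o G k) /\ 0 <= y k.
  elim: k => [|k [iG y0]]; first by split => //; exact: integrable0.
  have [[_ ib yy' _ _] _] := FP (k, st k) iG y0.
  split; first exact: (integrableD _ iG ib).
  by apply: le_trans yy'; rewrite addr_ge0.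
have spec k : step_spec k (G k) (y k) (b k) (y k.+1).
  by have [iG y0] := inv k; exact: FP (k, st k) iG y0.
have b0 k x : 0 <= b k x by have [[]] := spec k.
have ib k : mu.-integrable D (EFin \o b k) by have [[]] := spec k.
have y0 k : 0 <= y k by have [] := inv k.
have yS k : y k + 1 <= y k.+1 by have [[]] := spec k.
have ymono k n : (k <= n)%N -> y k <= y n.
  move=> kn; rewrite -(subnKC kn); elim: (n - k)%N => [|j IH]; first by rewrite addn0.
  by rewrite addnS (le_trans IH)// (le_trans _ (yS _))// lerDl.
have yge k : k%:R <= y k.
  elim: k => // k IH; apply: le_trans (yS k); by rewrite -natr1 lerD2r.
have SG t n : S t (G n) = \sum_(k < n) S t (b k).
  elim: n => [|n IH].
    rewrite big_ord0 /S; under eq_Rintegral do rewrite mulr0.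
    by rewrite Rintegral_cst// mul0r.
  rewrite big_ord_recr/= -IH /S -RintegralD//; last 2 first.
  - by apply: integrable_continuousM => //; have [] := inv n.
  - exact: integrable_continuousM.
  by apply: eq_Rintegral => x _; rewrite GS mulrDr.
have sumb n : \sum_(k < n) \int[mu]_(x in D) b k x <= 1.
  suff : \sum_(k < n) \int[mu]_(x in D) b k x <= 1 - 2^-1 ^+ n.
    by move/le_trans; apply; rewrite gerBl exprn_ge0.
  elim: n => [|n IH]; first by rewrite big_ord0 expr0 subrr.
  rewrite big_ord_recr/=; have [_ [bn _]] := spec n.
  by apply: (le_trans (lerD IH bn)); rewrite exprS; lra.
have [g [ig gS]] := @integrable_sum_functions _ _ R mu D (measurable_itv _) b 1
  (fun n x _ => b0 n x) ib sumb.
have Slim t : S t (G n) @[n --> \oo] --> S t g.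
  under eq_fun do rewrite SG.
  have [C C0 PC] := continuous_bounded_itv (fun x : R => Phi (x * t)) 0 1 (cPhiM t).
  apply: (gS (fun x => Phi (x * t)) C).
    exact: continuous_measurable_funTS.
  by move=> x; rewrite /= in_itv/= => /andP[x0 x1]; apply: PC; rewrite !ltW.
have Sge k : 1 <= `|S (y k.+1) g|.
  (* The power of 1/2 is the total that the humps still to come can subtract, which lets the
     induction close. *)
  have Sn n : 1 + 2^-1 ^+ (n + k.+1) <= `|S (y k.+1) (G (n + k.+1)%N)|.
    elim: n => [|n IH].
      rewrite add0n SG big_ord_recr/= -SG.
      have [[_ _ _ S1 S3] _] := spec k.
      have h1 : (2^-1 : R) ^+ k.+1 <= 1 by rewrite exprn_ile1// invf_le1// ler1n.
      have := lerB_normD (S (y k.+1) (b k)) (S (y k.+1) (G k)).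
      rewrite [S _ _ + _]addrC; lra.
    rewrite addSn SG big_ord_recr/= -SG.
    have [_ [_ St]] := spec (n + k.+1)%N.
    have := St (y k.+1); rewrite y0 ymono ?leq_addl// => /(_ isT).
    have := lerB_normD (S (y k.+1) (G (n + k.+1)%N)) (S (y k.+1) (b (n + k.+1)%N)).
    by move: IH; rewrite exprS; lra.
  have cvn : `|S (y k.+1) (G n)| @[n --> \oo] --> `|S (y k.+1) g| by exact: cvg_norm.
  rewrite -(cvg_lim _ cvn)//; apply: limr_ge; first by apply/cvg_ex; eexists; exact: cvn.
  exists k.+1 => // n /= kn; have := Sn (n - k.+1)%N; rewrite subnK//.
  by apply: le_trans; rewrite lerDl exprn_ge0.
have [N [_ Nlt]] := cvgr0_norm_lt _ (S_cvg0 _ ig) _ (@ltr01 R).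
have [k Nk] : exists k : nat, N < k%:R by exists (Num.trunc N).+1; exact: truncnS_gt.
suff : `|S (y k.+1) g| < 1 by rewrite ltNge Sge.
by apply: Nlt; apply: (lt_le_trans Nk); apply: (le_trans (yge k)); apply: ymono.
Qed.

End GlidingHump.

(** * The Bessel kernel *)

Section BesselKernel.
Context {R : realType}.
Variable nu : R.
Hypothesis hnu1 : -1 < nu.

(** Coefficients of the Bessel series in the variable [x ^+ 2], once [(x / 2) ^ nu] is factored
    out. *)
Definition bessel_series_coef (n : nat) : R :=
  (-1) ^+ n / (n`!%:R * Gamma (n%:R + nu + 1) * 4 ^+ n).

Local Notation a := bessel_series_coef.

Let nnu_gt0 (n : nat) : 0 < n%:R + nu + 1.
Proof. by rewrite -addrA ltr_wpDl// -ltrBlDr sub0r. Qed.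

Lemma bessel_series_coef_rec (n : nat) :
  n.+1%:R * (n%:R + (nu + 1)) * a n.+1 = - (a n / 4).
Proof.
rewrite /a.
have -> : n.+1%:R + nu + 1 = (n%:R + nu + 1) + 1 by rewrite -natr1; ring.
rewrite Gamma_rec//.
have := Gamma_gt0 _ (nnu_gt0 n); move: (Gamma _) => Ga Ga0.
rewrite !exprS factS natrM -natr1; field.
rewrite expf_neq0 ?pnatr_eq0// lt0r_neq0//= -lt0n fact_gt0/=.
by rewrite (lt0r_neq0 (nnu_gt0 n)) natr1 pnatr_eq0.
Qed.

(** As [n + nu + 1 >= nu + 1 > 0], the recurrence multiplies the absolute value by at most
    [K / (n + 1)] with [K = (4 * (nu + 1))^-1]. *)
Lemma fact_bounded_bessel_series_coef : fact_bounded a.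
Proof.
have m0 : 0 < nu + 1 by have := nnu_gt0 0; rewrite add0r.
exists `|a 0|, (4 * (nu + 1))^-1; split; first by rewrite invr_ge0 mulr_ge0// ltW.
elim=> [|n IH]; first by rewrite expr0 fact0 divr1 mulr1.
have nm : 0 < n%:R + (nu + 1) :> R by rewrite addrA.
have n1 : 0 < n.+1%:R * (n%:R + (nu + 1)) :> R by rewrite mulr_gt0.
have -> : a n.+1 = - (a n / (4 * (n.+1%:R * (n%:R + (nu + 1))))).
  apply: (mulfI (lt0r_neq0 n1)); rewrite bessel_series_coef_rec; field.
  by rewrite nat1r pnatr_eq0/= addrA gt_eqF.
rewrite normrN normrM normfV [X in _ / X]gtr0_norm; last by rewrite mulr_gt0.
apply: (@le_trans _ _ (`|a n| / (4 * (n.+1%:R * (nu + 1))))).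
  rewrite ler_wpM2l// lef_pV2 ?posrE ?mulr_gt0//.
  by rewrite ler_pM2l// ler_pM2l// lerDr.
apply: (@le_trans _ _
  (`|a 0| * ((4 * (nu + 1))^-1 ^+ n / n`!%:R) / (4 * (n.+1%:R * (nu + 1))))).
  by rewrite ler_wpM2r// invr_ge0 mulr_ge0// mulr_ge0// ltW.
rewrite le_eqVlt; apply/orP; left; apply/eqP.
rewrite exprS factS natrM; field.
by rewrite nat1r !pnatr_eq0/= -lt0n fact_gt0/= gt_eqF.
Qed.

Definition bessel_series (t : R) : R := limn (pseries a t).

Lemma bessel_phiE (x : R) : 0 < x ->
  bessel_phi nu x = 2^-1 `^ nu * bessel_series (x ^+ 2).
Proof.
move=> x0; have x20 : 0 < x / 2 by rewrite divr_gt0.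
have -> : bessel_phi nu x = x `^ (- nu) * ((x / 2) `^ nu * bessel_series (x ^+ 2)).
  congr (_ * _); rewrite /besselJ /bessel_series.
  have c := fact_bounded_cvg a (x ^+ 2) fact_bounded_bessel_series_coef.
  apply: cvg_lim => //.
  rewrite (_ : series _ = (fun n => (x / 2) `^ nu * pseries a (x ^+ 2) n)).
    by apply: cvgMr; exact: c.
  apply/funext => n; rewrite /pseries /series/= mulr_sumr; apply: eq_bigr => i _.
  rewrite /besselJ_coef /a -natrM powRD; last by rewrite (gt_eqF x20) implybT.
  rewrite powR_mulrn ?(ltW x20)// exprM expr_div_n.
  have -> : (2 : R) ^+ 2 = 4 by rewrite -natrX.
  have Gn0 := lt0r_neq0 (Gamma_gt0 _ (nnu_gt0 i)).
  rewrite expr_div_n; field.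
  by rewrite Gn0 pnatr_eq0 -lt0n fact_gt0/= expf_neq0.
rewrite mulrA powRM ?invr_ge0 ?(ltW x0)// mulrA -powRD.
  by rewrite addNr powRr0 mul1r.
by rewrite (gt_eqF x0) implybT.
Qed.

Hypothesis hnu2 : nu < - 2^-1.

(** The extension of [bessel_phi nu] from positive [x] to a function continuous on the whole
    line. *)
Definition bessel_kernel (x : R) : R := 2^-1 `^ nu * bessel_series (x ^+ 2).

Lemma is_derive_bessel_series (t : R) :
  is_derive t 1 bessel_series (limn (pseries (pseries_diffs a) t)).
Proof. exact: fact_bounded_is_derive fact_bounded_bessel_series_coef. Qed.

Lemma continuous_bessel_kernel : continuous bessel_kernel.
Proof.
move=> x; apply: cvgMr.
apply: (@continuous_comp _ _ _ (fun x : R => x ^+ 2) bessel_series).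
  exact: exprn_continuous.
exact: is_derive_continuous (is_derive_bessel_series _).
Qed.

(** With [m = nu + 1] the range of [nu] becomes [0 < m < 1/2], and the value of the series at 0 is
    the inverse of [Gamma (nu + 1)], hence nonzero. *)
Lemma bessel_kernel_unbounded (M : R) : exists2 t : R, 0 < t & M < `|bessel_kernel t|.
Proof.
have c0 : 0 < 2^-1 `^ nu :> R by rewrite powR_gt0 ?invr_gt0.
have b0 := fact_bounded_bessel_series_coef.
have b1 := fact_bounded_diffs _ b0.
have h0 : bessel_series 0 != 0.
  have -> : bessel_series 0 = a 0.
    apply: lim_near_cst => //; near=> n.
    rewrite /pseries/series/= (@big_ltn _ _ _ 0)//; last by near: n; exact: nbhs_infty_gt.
    rewrite expr0 mulr1 big_nat big1 ?addr0// => i /andP[i0 _].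
    by rewrite expr0n eqn0Ngt i0 mulr0.
  rewrite /a expr0 fact0 !mul1r mulr1 invr_eq0 gt_eqF//.
  by apply: Gamma_gt0; exact: nnu_gt0.
have m0 : 0 < nu + 1 by have := nnu_gt0 0; rewrite add0r.
have m1 : nu + 1 < 2^-1 by move: hnu2; lra.
have [u u0 Mu] := ode_solution_unbounded (nu + 1) bessel_series _ _ m0 m1
  is_derive_bessel_series (fun t => fact_bounded_is_derive _ t b1)
  (fun t => pseries_ode (nu + 1) a t b0 bessel_series_coef_rec) h0 (M / 2^-1 `^ nu).
exists (Num.sqrt u); first by rewrite sqrtr_gt0.
rewrite /bessel_kernel sqr_sqrtr ?(ltW u0)// normrM (gtr0_norm c0).
by rewrite mulrC -ltr_pdivrMr.
Unshelve. all: end_near. Qed.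

End BesselKernel.

Theorem theorem4p9 (R : realType) (nu r : R)
  (hnu1 : -1 < nu) (hnu2 : nu < - 2^-1) (hr : 1 < r) :
  ~ riemann_lebesgue_property nu r.
Proof.
move=> RL.
apply: (unbounded_kernel_not_cvg0 (bessel_kernel nu)
  (continuous_bessel_kernel nu hnu1)
  (bessel_kernel_unbounded nu hnu1 hnu2)) => g ig.
pose G : R -> R := g \_ `]0, 1[.
(* The power cancels the weight of the transform, which becomes the functional of the gliding hump
   at [g]; since [f] vanishes beyond 1 and [1 < r], the condition on ]r, +oo[ concerns the zero
   function. *)
pose f (x : R) : R := G x * x `^ (- (2 * nu + 1)).
have fE (x : R) : 0 < x -> f x * x `^ (2 * nu + 1) = G x.
  move=> x0; rewrite /f -mulrA -powRD ?addNr ?powRr0 ?mulr1//.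
  by rewrite (gt_eqF x0) implybT.
have domf : fourier_bessel_dom nu r f.
  split.
    have iG : (@lebesgue_measure R).-integrable `]0, r[ (EFin \o G).
      rewrite /G -restrict_EFin; apply/integrable_restrict => //.
      by rewrite setIidr//; apply: subset_itvl; rewrite bnd_simp ltW.
    apply: (eq_integrable _ _ _ _ iG) => //.
    by move=> x; rewrite inE/= in_itv/= => /andP[x0 _]; rewrite fE.
  have i0 := @integrable0 _ _ R (@lebesgue_measure R) `]r, +oo[%classic.
  apply: (eq_integrable _ _ _ _ i0) => //.
  move=> x; rewrite inE/= in_itv/= andbT => rx.
  rewrite /f /G patchE memNset ?mul0r//= in_itv/= => /andP[_].
  by rewrite ltNge (ltW (lt_trans hr rx)).
have [_ cvf] := RL f domf.
apply: cvg_trans cvf; apply: near_eq_cvg; near=> y.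
have y0 : 0 < y by near: y; exact: nbhs_pinfty_gt.
rewrite /fourier_bessel.
have -> : `]0 : R, 1[%classic = `]0, +oo[ `&` `]0, 1[.
  by rewrite setIidr//; apply: subset_itvl; rewrite bnd_simp.
rewrite Rintegral_mkcondr; apply: eq_Rintegral => x.
rewrite inE/= in_itv/= andbT => x0.
rewrite -mulrA fE// bessel_phiE ?mulr_gt0// /G !patchE.
by case: ifP => // _; rewrite mulr0.
Unshelve. all: end_near. Qed.
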